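(* Let $\mathcal{X}$ be a (real or complex) Banach space with $\dim \mathcal{X}\geq 2$, and let $\mathcal{N}$ be a nest on $\mathcal{X}$ such that each $N\in\mathcal{N}$ with $N_{-}=N$ is complemented in $\mathcal{X}$. For any linear map $\delta: Alg\mathcal{N}\rightarrow Alg\mathcal{N}$, the following are equivalent: (i) $\delta$ is a generalized derivation; (ii) $\delta$ is a local generalized derivation; (iii) $A\delta(B)C=0$ whenever $A,B,C\in Alg\mathcal{N}$ are such that $AB=BC=0$.
   Context: A nest $\mathcal{N}$ on a Banach space $\mathcal{X}$ is a chain (under inclusion) of norm-closed subspaces of $\mathcal{X}$ containing $\{0\}$ and $\mathcal{X}$ such that for every family $\{N_i\}$ of elements of $\mathcal{N}$, both $\bigcap N_i$ and $\bigvee N_i$ (the closed linear span of the $N_i$) belong to $\mathcal{N}$. The nest algebra $Alg\mathcal{N}$ is the algebra of all bounded linear operators on $\mathcal{X}$ that leave every member of $\mathcal{N}$ invariant. For $N\in\mathcal{N}$, $N_{-}:=\bigvee\{M\in\mathcal{N} : M\subsetneq N\}$. For an algebra $\mathcal{A}$, a linear map $\delta:\mathcal{A}\to\mathcal{A}$ is a generalized derivation if there is a linear map $\tau:\mathcal{A}\to\mathcal{A}$ such that $\delta(ab)=\delta(a)b+a\tau(b)$ for all $a,b\in\mathcal{A}$; when $\mathcal{A}$ is unital with unity $1$, this is equivalent to $\delta(ab)=\delta(a)b+a\delta(b)-a\delta(1)b$ for all $a,b\in\mathcal{A}$. A linear map $\delta:\mathcal{A}\to\mathcal{A}$ is a local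 generalized derivation if for each $a\in\mathcal{A}$ there is a generalized derivation $\delta_a:\mathcal{A}\to\mathcal{A}$, depending on $a$, with $\delta(a)=\delta_a(a)$. Linear maps are linear over the scalar field of $\mathcal{X}$ and are not assumed continuous. *)

(* Defs.v *)
From HB Require Import structures.
From mathcomp Require Import all_boot all_order all_algebra.
From mathcomp Require Import complex.
From mathcomp Require Import boolp classical_sets functions reals topology.
From mathcomp Require Import normedtype.

Set Implicit Arguments.
Unset Strict Implicit.
Unset Printing Implicit Defensive.

Import Order.TTheory GRing.Theory Num.Theory.
Import numFieldNormedType.Exports.

Local Open Scope classical_set_scope.
Local Open Scope ring_scope.

Variant scalar_kind := RealScalars | ComplexScalars.

Definition scalars (R : realType) (k : scalar_kind) : numFieldType :=
  match k with
  | RealScalars => R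
  | ComplexScalars => R[i]
  end.

Section Subspaces.
Context {K : numFieldType} {X : normedModType K}.

Definition linear_subspace (M : set X) : Prop :=
  M 0 /\ forall (a : K) (x y : X), M x -> M y -> M (a *: x + y).

Definition closed_subspace (M : set X) : Prop := linear_subspace M /\ closed M.

Definition closed_span (A : set X) : set X :=
  closure (smallest linear_subspace A).

(* For closed L: the complement is required to be closed as well. *)
Definition complemented (L : set X) : Prop :=
  exists M : set X, [/\ closed_subspace M,
    L `&` M = [set 0] &
    forall x, exists y z, [/\ L y, M z & x = y + z]].

Definition bounded_operator (T : X -> X) : Prop :=
  linear T /\ exists C : K, forall x, `|T x| <= C * `|x|.

End Subspaces.

Definition dim_ge (K : pzRingType) (V : lmodType K) (n : nat) : Prop :=
  exists v : 'I_n -> V, forall c : 'I_n -> K,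
    \sum_(i < n) c i *: v i = 0 -> forall i, c i = 0.

Definition is_nest (K : numFieldType) (X : normedModType K)
    (N : set (set X)) : Prop :=
  [/\ forall M, N M -> closed_subspace M,
      total_on N subset,
      N [set 0] /\ N setT &
      forall F : set (set X), F `<=` N ->
        N (\bigcap_(M in F) M) /\ N (closed_span (\bigcup_(M in F) M))].

Record nest (K : numFieldType) (X : normedModType K) := Nest {
  members : set (set X);
  nestP : is_nest members
}.

Section NestAlgebra.
Context {K : numFieldType} {X : normedModType K}.

Definition nest_prev (N : nest X) (L : set X) : set X :=
  closed_span (\bigcup_(M in [set M | members N M /\ M `<` L]) M).

Definition in_nest_algebra (N : nest X) : {pred X -> X} :=
  fun T => `[< bounded_operator T /\
               forall M, members N M -> forall x, M x -> M (T x) >].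

Record nest_algebra (N : nest X) := NestAlgebra {
  nest_op :> X -> X;
  nest_opP : nest_op \in in_nest_algebra N
}.

HB.instance Definition _ (N : nest X) := [isSub for @nest_op N].
HB.instance Definition _ (N : nest X) := [Choice of nest_algebra N by <:].

Lemma in_nest_algebra_submod (N : nest X) : submod_closed (in_nest_algebra N).
Proof.
have [closedN _ _ _] := nestP N; split.
  apply/asboolP; split; first split.
  - by move=> a x y /=; rewrite scaler0 addr0.
  - by exists 0 => x; rewrite normr0 mul0r.
  - by move=> M /closedN[[M0 _] _] x _.
move=> a S T /asboolP[[linS [B hB]] SN] /asboolP[[linT [C hC]] TN].
apply/asboolP; split; first split.
- move=> b x y; rewrite !fctE linS linT !scalerDr !scalerA (mulrC a b).
  by rewrite addrACA.
- exists (`|a| * B + C) => x; rewrite !fctE mulrDl -mulrA.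
  by rewrite (le_trans (ler_normD _ _))// lerD// normrZ ler_wpM2l.
- move=> M NM x Mx; have [[_ linM] _] := closedN _ NM.
  by rewrite fctE; apply: linM; [exact: SN|exact: TN].
Qed.

HB.instance Definition _ (N : nest X) :=
  GRing.isSubmodClosed.Build K (X -> X) (in_nest_algebra N)
    (in_nest_algebra_submod N).
HB.instance Definition _ (N : nest X) :=
  [SubChoice_isSubLmodule of nest_algebra N by <:].

Lemma in_nest_algebra_id (N : nest X) : idfun \in in_nest_algebra N.
Proof. by apply/asboolP; do !split => //; exists 1 => x; rewrite mul1r. Qed.

Lemma in_nest_algebra_comp (N : nest X) (S T : nest_algebra N) :
  nest_op S \o nest_op T \in in_nest_algebra N.
Proof.
case: S T => [S /= /asboolP[[linS [B hB]] SN]] [T /= /asboolP[[linT [C hC]] TN]].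
apply/asboolP; split; first split.
- by move=> a x y /=; rewrite linT linS.
- exists (`|B| * C) => x /=; rewrite (le_trans (hB _))//.
  have [->|Tx0] := eqVneq (T x) 0.
    by rewrite normr0 mulr0 -mulrA mulr_ge0// (le_trans _ (hC x)).
  have B0 : 0 <= B.
    by rewrite -(pmulr_lge0 B (x := `|T x|)) ?normr_gt0// (le_trans _ (hB _)).
  by rewrite ger0_norm// -mulrA ler_wpM2l.
- by move=> M NM x Mx; apply: SN => //; exact: TN.
Qed.

Definition nest_algebra_one (N : nest X) : nest_algebra N :=
  NestAlgebra (in_nest_algebra_id N).

Definition nest_algebra_mul (N : nest X) (S T : nest_algebra N) :
  nest_algebra N := NestAlgebra (in_nest_algebra_comp S T).

Lemma nest_opD (N : nest X) (S T : nest_algebra N) x : (S + T) x = S x + T x.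
Proof. by []. Qed.

Lemma nest_opZ (N : nest X) (a : K) (T : nest_algebra N) x :
  (a *: T) x = a *: T x.
Proof. by []. Qed.

Lemma nest_op_linear (N : nest X) (T : nest_algebra N) : linear T.
Proof. by have /asboolP[[]] := nest_opP T. Qed.

Lemma nest_op_ext (N : nest X) (S T : nest_algebra N) :
  (forall x, S x = T x) -> S = T.
Proof. by move=> ST; apply/val_inj/funext. Qed.

Fact nest_mulA (N : nest X) : associative (@nest_algebra_mul N).
Proof. by move=> S T U; exact: nest_op_ext. Qed.
Fact nest_mul1l (N : nest X) :
  left_id (nest_algebra_one N) (@nest_algebra_mul N).
Proof. by move=> S; exact: nest_op_ext. Qed.
Fact nest_mul1r (N : nest X) :
  right_id (nest_algebra_one N) (@nest_algebra_mul N).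
Proof. by move=> S; exact: nest_op_ext. Qed.
Fact nest_mulDl (N : nest X) :
  left_distributive (@nest_algebra_mul N) +%R.
Proof. by move=> S T U; exact: nest_op_ext. Qed.
Fact nest_mulDr (N : nest X) :
  right_distributive (@nest_algebra_mul N) +%R.
Proof.
move=> S T U; apply: nest_op_ext => x.
by have /= := nest_op_linear S 1 (T x) (U x); rewrite !scale1r.
Qed.

HB.instance Definition _ (N : nest X) :=
  GRing.Zmodule_isPzRing.Build (nest_algebra N)
    (@nest_mulA N) (@nest_mul1l N) (@nest_mul1r N)
    (@nest_mulDl N) (@nest_mulDr N).

Lemma nest_op1 (N : nest X) x : (1 : nest_algebra N) x = x.
Proof. by []. Qed.

Lemma nest_opM (N : nest X) (S T : nest_algebra N) x : (S * T) x = S (T x).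
Proof. by []. Qed.

Lemma nest_scalerAl (N : nest X) (a : K) (S T : nest_algebra N) :
  a *: (S * T) = (a *: S) * T.
Proof. exact: nest_op_ext. Qed.
Lemma nest_scalerAr (N : nest X) (a : K) (S T : nest_algebra N) :
  a *: (S * T) = S * (a *: T).
Proof.
apply: nest_op_ext => x; rewrite !(nest_opZ, nest_opM).
have S0 : S 0 = 0.
  by have /= := nest_op_linear S (-1) 0 0; rewrite scaler0 addr0 scaleN1r addNr.
by have /= := nest_op_linear S a (T x) 0; rewrite S0 !addr0.
Qed.

End NestAlgebra.

(* The nest algebra is given as a module and a possibly zero ring, not as an
   algType, because algType requires 1 != 0, which fails when X is zero. *)
Section GeneralizedDerivations.
Context {K : numFieldType} {X : normedModType K} {N : nest X}.
Local Notation A := (nest_algebra N).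

Definition generalized_derivation (delta : {linear A -> A}) : Prop :=
  exists tau : {linear A -> A},
    forall a b : A, delta (a * b) = delta a * b + a * tau b.

Definition local_generalized_derivation (delta : {linear A -> A}) : Prop :=
  forall a : A, exists2 delta_a : {linear A -> A},
    generalized_derivation delta_a & delta a = delta_a a.

End GeneralizedDerivations.

(* Main.v *)
Require Import Defs.
From HB Require Import structures.
From mathcomp Require Import all_boot all_order all_algebra.
From mathcomp Require Import complex.
From mathcomp Require Import boolp classical_sets functions reals topology.
From mathcomp Require Import normedtype.
From mathcomp Require Import sequences lra.

(** The only substantial implication is that a map [delta] with
    [S delta(T) Q = 0] whenever [S T = T Q = 0] is a generalized derivation.
    Consider the defect
    [E(S, T, Q) = delta(STQ) - delta(ST) Q - S delta(TQ) + S delta(T) Q];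
    the equation [E(S, 1, Q) = 0] says that [delta] is a generalized
    derivation with [tau(Q) = delta(Q) - delta(1) Q].

    If [P] and [Q] are idempotent, testing the hypothesis on the four products
    of [P], [1 - P] with [Q], [1 - Q] gives [E(P, T, Q) = 0]
    ([defect_idempotent]), so [E(S, T, Q)] vanishes for [S] and [Q] in the
    linear span of the idempotents.  The identity
    [E(U S, T, Q) = E(U, S T, Q) + U E(S, T, Q)] and its mirror image carry the
    vanishing further: if [U] and [V] run over a set of operators that is
    stable under multiplication by the algebra and contained in this span, then
    [U E(S, T, Q) V = 0] for arbitrary [S], [T], [Q].

    The set used is that of the rank one operators [y |-> f(y) x], with [x] in
    a member [M] of the nest and [f] a bounded functional vanishing on the
    predecessor of [M].  By the Hahn-Banach theorem there are enough of them to
    separate operators ([rank_one_faithful]).  They are combinations of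
    idempotents ([rank_one_idempotent_span]): if the predecessor of [M] is
    smaller than [M], a functional can be perturbed so as not to vanish at
    [x], and a rank one operator with [f(x) != 0] is a multiple of an
    idempotent; if [M] is its own predecessor, then [f] vanishes on [M], and
    for a bounded projection [P] onto [M] both [P] and [P + S] are idempotent,
    [S] being the rank one operator.  That the projection attached to a closed
    complement is bounded is a case of the closed graph theorem, proved from
    Baire's theorem ([complement_projection_bounded]).

    Both analytic ingredients are proved over the reals and transported to
    complex spaces by restricting the scalars ([realified]). *)

Set Implicit Arguments.
Unset Strict Implicit.
Unset Printing Implicit Defensive.

Import Order.TTheory GRing.Theory Num.Theory.
Import numFieldNormedType.Exports.

Local Open Scope classical_set_scope.
Local Open Scope ring_scope.

(** * Sublinear maps and the Hahn-Banach theorem *)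

Section HahnBanach.
Context {R : realType} {V : lmodType R}.
Implicit Types (p q : V -> R) (x y : V).

Definition sublinear q : Prop :=
  (forall x y, q (x + y) <= q x + q y) /\
  (forall t x, 0 < t -> q (t *: x) <= t * q x).

Lemma sublinear0 q : sublinear q -> q 0 = 0.
Proof.
move=> [_ qZ]; have := qZ 2 0; have := qZ 2^-1 0; rewrite !scaler0.
by rewrite invr_gt0 ltr0n => /(_ isT) + /(_ isT); lra.
Qed.

Lemma sublinearN q x : sublinear q -> - q (- x) <= q x.
Proof.
move=> sq; have := sq.1 x (- x); rewrite subrr (sublinear0 sq); lra.
Qed.

Lemma sublinear_ge0 q t x : sublinear q -> 0 <= t -> q (t *: x) <= t * q x.
Proof.
move=> sq; rewrite le_eqVlt => /predU1P[<-|/sq.2//].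
by rewrite scale0r mul0r sublinear0.
Qed.

(** Lowering a sublinear [q] along the direction [y]: the result is still
    sublinear, lies below [q], and takes the value [- q y] or less at [- y].
    It makes minimal sublinear maps additive, and it forces the value
    [p x0] in the Hahn-Banach theorem. *)
Definition descent q y x : R :=
  inf [set q (x + t *: y) - t * q y | t in [set t : R | 0 <= t]].

Lemma descent_lb q y x : sublinear q ->
  lbound [set q (x + t *: y) - t * q y | t in [set t : R | 0 <= t]] (- q (- x)).
Proof.
move=> sq _ [t /= t0 <-].
have := sq.1 (x + t *: y) (- x); rewrite addrAC subrr add0r => h1.
have h3 : t * q y <= q (t *: y).
  move: t0; rewrite le_eqVlt => /predU1P[<-|t0].
    by rewrite scale0r mul0r sublinear0.
  have := sq.2 t^-1 (t *: y); rewrite invr_gt0 scalerA mulVf ?gt_eqF// scale1r.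
  by move=> /(_ t0); rewrite mulrC ler_pdivlMr// mulrC.
by move: h1 h3; lra.
Qed.

Lemma descent_le q y x t : sublinear q -> 0 <= t ->
  descent q y x <= q (x + t *: y) - t * q y.
Proof.
move=> sq t0; apply: ge_inf; last by exists t.
by exists (- q (- x)); exact: descent_lb.
Qed.

Lemma le_descent q y x r :
  (forall t, 0 <= t -> r <= q (x + t *: y) - t * q y) -> r <= descent q y x.
Proof.
move=> rle; apply: lb_le_inf.
  by exists (q (x + 0 *: y) - 0 * q y), 0 => /=.
by move=> _ [t /= t0 <-]; exact: rle.
Qed.

Lemma descent_sublinear q y : sublinear q -> sublinear (descent q y).
Proof.
move=> sq; split=> [x x'|c x c0].
  rewrite -lerBlDl; apply: le_descent => t t0.
  rewrite lerBlDl -lerBlDr; apply: le_descent => s s0; rewrite lerBlDr.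
  apply: le_trans (descent_le y (x + x') sq (addr_ge0 s0 t0)) _.
  have := sq.1 (x + s *: y) (x' + t *: y).
  by rewrite scalerDl addrACA mulrDl; lra.
rewrite -ler_pdivrMl//; apply: le_descent => t t0; rewrite ler_pdivrMl//.
apply: le_trans (descent_le y (c *: x) sq (mulr_ge0 (ltW c0) t0)) _.
by rewrite -scalerA -scalerDr mulrBr mulrA lerB// sq.2.
Qed.

Lemma descent_le_id q y x : sublinear q -> descent q y x <= q x.
Proof.
move=> sq; apply: le_trans (descent_le y x sq (lexx 0)) _.
by rewrite scale0r addr0 mul0r subr0.
Qed.

(** The pointwise infimum of a chain of sublinear maps below [p] is finite
    because [- p (- x)] bounds all of them at [x], and it is sublinear because
    any two members of the chain are comparable; so Zorn's lemma applies. *)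
Lemma minimal_sublinear p : sublinear p ->
  exists q, [/\ sublinear q, forall x, q x <= p x &
    forall q', sublinear q' -> (forall x, q' x <= q x) -> q' = q].
Proof.
move=> sp.
pose T := {q : V -> R | sublinear q /\ forall x, q x <= p x}.
pose below (a b : T) := `[< forall x, sval b x <= sval a x >].
have [||||[q [sq qp]] qmin] := @Zorn T below.
- by move=> a; apply/asboolP.
- move=> b a c /asboolP ab /asboolP bc.
  by apply/asboolP => x; exact: le_trans (bc x) (ab x).
- move=> [a ha] [b hb] /asboolP ab /asboolP ba; apply: eq_exist => /=.
  by apply/funext => x; apply/eqP; rewrite eq_le ab ba.
- move=> A totA.
  have [[a0 Aa0]|A0] := pselect (A !=set0); last first.
    by exists (exist _ p (conj sp (fun=> lexx _))) => s As; case: A0; exists s.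
  pose S x := [set sval a x | a in A].
  have lbS x : has_lbound (S x).
    exists (- p (- x)) => _ [[a [sa ap]] /= _ <-].
    by apply: le_trans (sublinearN x sa); rewrite lerN2.
  have Sle a x : A a -> inf (S x) <= sval a x.
    by move=> Aa; apply: ge_inf => //; exists a.
  have leS r x : (forall a, A a -> r <= sval a x) -> r <= inf (S x).
    move=> rle; apply: lb_le_inf; first by exists (sval a0 x), a0.
    by move=> _ [a Aa <-]; exact: rle.
  have sS : sublinear (fun x => inf (S x)).
    split=> [x y|t x t0].
      rewrite -lerBlDl; apply: (leS _ y) => b Ab.
      rewrite lerBlDl -lerBlDr; apply: (leS _ x) => a Aa; rewrite lerBlDr.
      have [/asboolP ab|/asboolP ba] := totA _ _ Aa Ab.
        apply: le_trans (Sle _ _ Ab) _; apply: le_trans ((svalP b).1.1 x y) _.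
        by rewrite lerD2r.
      apply: le_trans (Sle _ _ Aa) _; apply: le_trans ((svalP a).1.1 x y) _.
      by rewrite lerD2l.
    rewrite -ler_pdivrMl//; apply: leS => a Aa; rewrite ler_pdivrMl//.
    exact: le_trans (Sle _ _ Aa) ((svalP a).1.2 _ _ t0).
  have Sp x : inf (S x) <= p x.
    exact: le_trans (Sle a0 x Aa0) ((svalP a0).2 x).
  exists (exist _ (fun x => inf (S x)) (conj sS Sp)) => a Aa.
  by apply/asboolP => x /=; exact: Sle.
exists q; split=> // q' sq' q'q.
have q'p x : q' x <= p x := le_trans (q'q x) (qp x).
have := qmin (exist _ q' (conj sq' q'p)).
by move=> /(_ (asboolT q'q)) /(congr1 sval).
Qed.

(** Minimality gives [descent q y = q], hence [q x <= q (x + y) - q y], which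
    is the missing half of additivity. *)
Lemma minimal_sublinear_linear q : sublinear q ->
  (forall q', sublinear q' -> (forall x, q' x <= q x) -> q' = q) -> scalar q.
Proof.
move=> sq qmin.
have qD x y : q (x + y) = q x + q y.
  apply/eqP; rewrite eq_le sq.1/= -lerBrDr.
  rewrite -{1}(qmin _ (descent_sublinear y sq) (fun x => descent_le_id y x sq)).
  apply: le_trans (descent_le y x sq ler01) _.
  by rewrite scale1r mul1r.
have qN x : q (- x) = - q x.
  by apply/eqP; rewrite -addr_eq0 -qD addNr sublinear0.
have qZ t x : 0 <= t -> q (t *: x) = t * q x.
  move=> t0; apply/eqP; rewrite eq_le sublinear_ge0//= -lerN2 -qN -mulrN -qN.
  by rewrite -scalerN sublinear_ge0.
move=> a x y; rewrite qD; congr (_ + _).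
have [/qZ//|/ltW a0] := leP 0 a.
by apply: oppr_inj; rewrite -qN -scaleNr qZ ?oppr_ge0// mulNr.
Qed.

(** Starting from the descent of [p] along [x0] instead of [p] itself yields
    [f (- x0) <= - p x0], so that [f] attains [p] at [x0].  No functional has to
    be extended from a subspace. *)
Theorem hahn_banach p x0 : sublinear p ->
  exists2 f : V -> R, scalar f & f x0 = p x0 /\ forall x, f x <= p x.
Proof.
move=> sp.
have [f [sf fle fmin]] := minimal_sublinear (descent_sublinear x0 sp).
have fp x : f x <= p x := le_trans (fle x) (descent_le_id x0 x sp).
exists f; first exact: minimal_sublinear_linear.
split=> //; apply/eqP; rewrite eq_le fp/=.
have := le_trans (fle (- x0)) (descent_le x0 (- x0) sp ler01).
rewrite scale1r addNr (sublinear0 sp) mul1r sub0r.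
by have := sublinearN (- x0) sf; rewrite opprK; lra.
Qed.

End HahnBanach.

(** * Linear subspaces and projections *)

Section Subspace.
Context {K : numFieldType} {X : normedModType K}.
Implicit Types L M : set X.

Lemma linear_subspaceD L x y : linear_subspace L -> L x -> L y -> L (x + y).
Proof. by move=> [_ sL] Lx Ly; have := sL 1 x y Lx Ly; rewrite scale1r. Qed.

Lemma linear_subspaceZ L a x : linear_subspace L -> L x -> L (a *: x).
Proof. by move=> [L0 sL] Lx; have := sL a x 0 Lx L0; rewrite addr0. Qed.

Lemma linear_subspaceN L x : linear_subspace L -> L x -> L (- x).
Proof. by rewrite -scaleN1r; exact: linear_subspaceZ. Qed.

Lemma linear_subspaceB L x y :
  linear_subspace L -> L x -> L y -> L (x - y).
Proof.
by move=> sL Lx Ly; apply: linear_subspaceD => //; exact: linear_subspaceN.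
Qed.

Definition bounded_functional (f : X -> K) : Prop :=
  scalar f /\ exists2 C : K, 0 <= C & forall x, `|f x| <= C * `|x|.

Lemma complement_projection L M : linear_subspace L -> linear_subspace M ->
  L `&` M = [set 0] ->
  (forall x, exists y z, [/\ L y, M z & x = y + z]) ->
  exists P : {linear X -> X}, forall x, L (P x) /\ M (x - P x).
Proof.
move=> sL sM LM0 sumLM.
have /choice[P Pp] x : exists y, L y /\ M (x - y).
  by have [y [z [Ly Mz ->]]] := sumLM x; exists y; rewrite addrC addKr.
suff linP : linear P.
  pose Q : {linear X -> X} := HB.pack P (GRing.isLinear.Build _ _ _ _ _ linP).
  by exists Q => x; exact: Pp.
move=> a x y; apply/eqP; rewrite -subr_eq0.
suff : (L `&` M) (P (a *: x + y) - (a *: P x + P y)) by rewrite LM0 => ->.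
split.
  by apply: linear_subspaceB (Pp _).1 _ => //; apply: sL.2; apply: (Pp _).1.
have -> : P (a *: x + y) - (a *: P x + P y) =
    (a *: (x - P x) + (y - P y)) - (a *: x + y - P (a *: x + y)).
  by rewrite scalerBr addrACA -opprD opprB [RHS]addrC addrA subrK.
by apply: linear_subspaceB (Pp _).2 => //; apply: sM.2; apply: (Pp _).2.
Qed.

End Subspace.

Section ProjectionBounded.
Context {R : realType} {X : completeNormedModType R}.
Variables (L M : set X) (P : {linear X -> X}).
Hypotheses (cL : closed_subspace L) (cM : closed_subspace M).
Hypothesis LM0 : L `&` M = [set 0].
Hypothesis PLM : forall x, L (P x) /\ M (x - P x).

Let A (n : nat) : set X := [set x | `|P x| <= n%:R].

(** The sets [A n] cover the space, so by Baire's theorem the closure of one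
    of them has an interior point. *)
Lemma sublevel_closure_ball :
  exists n x (r : R), 0 < r /\ ball x r `<=` closure (A n).
Proof.
have : ~ (forall n, open (~` closure (A n)) /\ dense (~` closure (A n))).
  move/Baire; rewrite [X in dense X](_ : _ = set0); first exact: dense0.
  rewrite -subset0 => x /(_ (Num.truncn `|P x|).+1 Logic.I); apply.
  by apply: subset_closure; rewrite /A/= ltW// truncnS_gt.
move=> /existsNP[n nd]; have {nd} /denseNE : ~ dense (~` closure (A n)).
  by move=> d; apply: nd; split=> //; apply/closed_openC; exact: closed_closure.
move=> [O [[x [oO Ox]] /disjoints_subset]]; rewrite setCK => OA.
have /nbhs_ballP[r /= r0 rO] : nbhs x O by apply: open_nbhs_nbhs.
by exists n, x, r; split=> //; exact: subset_trans OA.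
Qed.

(** Differences of two points of [A n] fill the ball of radius [r] around the
    origin densely, and scaling makes the bound on the image homogeneous. *)
Lemma small_image_approximation : exists2 C, 0 <= C &
  forall x (d : R), 0 < d -> exists2 a, `|P a| <= C * `|x| & `|x - a| <= d.
Proof.
have [n [x0 [r [r0 rA]]]] := sublevel_closure_ball.
exists (4 * n%:R / r) => [|x d d0].
  by rewrite divr_ge0 ?mulr_ge0 ?(ltW r0).
have [->|x_neq0] := eqVneq x 0.
  by exists 0; rewrite ?subr0 ?linear0 !normr0 ?mulr0 ?(ltW d0).
have nx0 : 0 < `|x| by rewrite normr_gt0.
(* This factor puts [x0 + s *: x] inside the ball of radius [r] around [x0]. *)
pose s := r / (2 * `|x|).
have s0 : 0 < s by rewrite divr_gt0// mulr_gt0.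
have near_A y : ball x0 r y ->
    exists2 a, `|P a| <= n%:R & `|y - a| <= s * d / 2.
  have sd0 : 0 < s * d / 2 by apply: divr_gt0 => //; exact: mulr_gt0.
  move=> /rA /(_ _ (nbhsx_ballx y _ sd0))[a []].
  by rewrite -ball_normE /= => Aa /ltW; exists a.
have [|a1 Pa1 ya1] := near_A (x0 + s *: x).
  rewrite -ball_normE /= opprD addNKr normrN normrZ gtr0_norm//.
  rewrite /s invfM mulrA mulfVK ?gt_eqF// ltr_pdivrMr//; lra.
have [|a2 Pa2 ya2] := near_A x0; first exact: ballxx.
exists (s^-1 *: (a1 - a2)).
  rewrite linearZ/= normrZ gtr0_norm ?invr_gt0// linearB/= /s invf_div.
  have := ler_normB (P a1) (P a2); set u := `|P a1 - P a2| => hu.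
  have -> : 4 * n%:R / r * `|x| = 2 * `|x| / r * (2 * n%:R) by lra.
  by rewrite ler_pM2l ?divr_gt0 ?mulr_gt0//; lra.
have -> : x - s^-1 *: (a1 - a2) = s^-1 *: ((x0 + s *: x - a1) - (x0 - a2)).
  rewrite -[x in LHS](scalerK (lt0r_neq0 s0)) -scalerBr; congr (_ *: _).
  by rewrite !opprB [RHS]addrC -!addrA addKr addrCA.
rewrite normrZ gtr0_norm ?invr_gt0// mulrC ler_pdivrMr// (mulrC d).
by apply: le_trans (ler_normB _ _) _; lra.
Qed.

(** Iterating the approximation writes [x] as the sum of a series whose terms
    have images of geometrically decreasing norm.  The images sum to some [l],
    in [L] since [L] is closed; so [P x - l] is in [L].  Its opposite is in [M],
    being the limit of the points [y k - P (y k)], as [y k] tends to 0.  Hence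
    [P x = l], whose norm is bounded by the sum of the geometric series. *)
Lemma complement_projection_bounded : exists C, forall x, `|P x| <= C * `|x|.
Proof.
have [C C0 approx] := small_image_approximation.
exists (2 * C) => x.
have [->|x_neq0] := eqVneq x 0; first by rewrite linear0 normr0 mulr0.
have nx0 : 0 < `|x| by rewrite normr_gt0.
pose e k : R := geometric `|x| 2^-1 k.
have e0 k : 0 < e k by rewrite /e/= mulr_gt0 ?exprn_gt0 ?invr_gt0.
have eS k : e k = 2 * e k.+1 by rewrite /e/= exprS; lra.
have /choice[f fP] (ky : nat * X) : exists a, `|P a| <= C * `|ky.2| /\
    `|ky.2 - a| <= e ky.1.+1.
  by have [a ? ?] := approx ky.2 _ (e0 ky.1.+1); exists a.
(* The remainder after [k] approximation steps. *)
pose fix y k : X := if k is k'.+1 then y k' - f (k', y k') else x.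
have ye k : `|y k| <= e k.
  by case: k => [|k]; [rewrite /e/= expr0 mulr1|exact: (fP (k, y k)).2].
pose u k : X := P (f (k, y k)).
have ue k : `|u k| <= C * e k.
  by apply: le_trans (fP (k, y k)).1 _; rewrite ler_wpM2l ?ye.
have seriesE k : series u k = P x - P (y k).
  elim: k => [|k IH]; first by rewrite /series/= big_geq// subrr.
  by rewrite seriesSr IH /u/= linearB/= opprB addrAC addrA.
have half : `|2^-1 : R| < 1 by rewrite ger0_norm; lra.
have /cvg_ex[l /= ul] : cvgn (series u).
  apply: normed_cvg; apply: (@series_le_cvg _ _ (geometric (C * `|x|) 2^-1)).
  - by move=> k; exact: normr_ge0.
  - by move=> k /=; rewrite -mulrA mulr_ge0 ?(ltW (e0 k)).
  - by move=> k /=; rewrite -mulrA; exact: ue.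
  - exact: is_cvg_geometric_series.
have y0 : y @ \oo --> (0 : X).
  apply/norm_cvg0P.
  apply: (squeeze_cvgr _ (@cvg_cst _ _ _ _ _) (cvg_geometric `|x| half)).
  by apply: nearW => k; rewrite normr_ge0 ye.
have Py : (fun k => P (y k)) @ \oo --> P x - l.
  rewrite (_ : (fun k => _) = (fun k => P x - series u k)).
    by apply: cvgB => //; exact: cvg_cst.
  by apply/funext => k; rewrite seriesE subKr.
have Ll : L l.
  apply: (closed_cvg L cL.2 _ _ ul); apply: nearW => k.
  by rewrite seriesE; apply: linear_subspaceB (PLM _).1 (PLM _).1; exact: cL.1.
have Ml : M (- (P x - l)).
  rewrite -[X in M X]sub0r; apply: (closed_cvg M cM.2 _ _ (cvgB y0 Py)).
  by apply: nearW => k; exact: (PLM _).2.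
have Pxl : P x - l = 0.
  suff : (L `&` M) (P x - l) by rewrite LM0.
  split; first by apply: linear_subspaceB (PLM _).1 Ll; exact: cL.1.
  by rewrite -[_ - _]opprK; apply: linear_subspaceN Ml; exact: cM.1.
(* The bracket is the sum of the first [k] values of [e]. *)
have sume k : `|series u k| <= C * (2 * `|x| - 2 * e k).
  elim: k => [|k IH].
    by rewrite /series/= big_geq// normr0 mulr_ge0// /e/= expr0 mulr1 subrr.
  rewrite seriesSr (le_trans (ler_normD _ _))//.
  by have := ue k; move: IH; rewrite (eS k); lra.
move/eqP: Pxl; rewrite subr_eq0 => /eqP ->.
apply: (closed_cvg (fun z : X => `|z| <= 2 * C * `|x|) _ _ _ ul).
  rewrite (_ : (fun _ => _) = closed_ball_ Num.norm 0 (2 * C * `|x|)).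
    exact: closed_closed_ball_.
  by apply/funext => z; rewrite /closed_ball_/= sub0r normrN.
apply: nearW => k; apply: le_trans (sume k) _.
by have := mulr_ge0 C0 (ltW (e0 k)); lra.
Qed.

End ProjectionBounded.

(** * Restriction of scalars from the complex to the real numbers *)

(** The alias carries the restricted scalar action and a real-valued norm, so
    that a complex space and its underlying real space do not compete for the
    inferred structures of a single type. *)
Definition realified (R : realType) (X : Type) : Type := X.

Section Realification.
Context {R : realType} {X : normedModType R[i]}.
Local Notation Xr := (realified R X).
Local Notation toC := (real_complex R).

HB.instance Definition _ := GRing.Zmodule.copy Xr X.

Definition real_scale (a : R) (x : Xr) : Xr := (toC a) *: (x : X).

Fact real_scalerA a b x : real_scale a (real_scale b x) = real_scale (a * b) x.
Proof. by rewrite /real_scale scalerA rmorphM. Qed.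
Fact real_scale1r : left_id 1 real_scale.
Proof. by move=> x; rewrite /real_scale rmorph1 scale1r. Qed.
Fact real_scalerDr : right_distributive real_scale +%R.
Proof. by move=> a x y; rewrite /real_scale scalerDr. Qed.
Fact real_scalerDl x : {morph real_scale^~ x : a b / a + b}.
Proof. by move=> a b; rewrite /real_scale rmorphD scalerDl. Qed.

HB.instance Definition _ := GRing.Zmodule_isLmodule.Build R Xr
  real_scalerA real_scale1r real_scalerDr real_scalerDl.

Definition real_norm (x : Xr) : R := complex.Re `|x : X|.

Lemma real_normE (x : X) : toC (real_norm x) = `|x|.
Proof. by apply: RRe_real; exact: normr_real. Qed.

Fact real_normD x y : real_norm (x + y) <= real_norm x + real_norm y.
Proof. by rewrite -lecR rmorphD/= !real_normE ler_normD. Qed.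
Fact real_normZ a x : real_norm (a *: x) = `|a| * real_norm x.
Proof.
apply: complexI; rewrite rmorphM/= !real_normE normrZ; congr (_ * _).
by rewrite normc_def/= expr0n/= addr0 sqrtr_sqr.
Qed.
Fact real_norm0_eq0 x : real_norm x = 0 -> x = 0.
Proof.
by move=> x0; apply/normr0_eq0; rewrite -real_normE x0.
Qed.

HB.instance Definition _ := Lmodule_isNormed.Build R Xr
  real_normD real_normZ real_norm0_eq0.

Lemma nbhs_realified (x : X) (A : set X) : nbhs (x : Xr) A <-> nbhs x A.
Proof.
have nR : nbhs (x : Xr) A <-> nbhs_ball_ (ball_ (@Num.norm R Xr)) x A.
  exact: (@nbhs_normP R Xr x A).
split=> [/nR[e /= e0 eA]|/(@nbhs_normP _ X)[e /= e0 eA]].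
  apply/(@nbhs_normP _ X); exists (toC e); first by rewrite /= ltcR.
  by move=> y /=; rewrite -real_normE ltcR; exact: eA.
have re : toC (complex.Re e) = e by apply: RRe_real; exact: gtr0_real.
apply/nR; exists (complex.Re e); first by rewrite /= -ltcR re.
by move=> y /=; rewrite -ltcR re => ye; apply: eA; rewrite /= -real_normE.
Qed.

Lemma closed_realified (A : set X) : closed A -> closed (A : set Xr).
Proof. by move=> cA x Ax; apply: cA => B /nbhs_realified; exact: Ax. Qed.

End Realification.

Section CompleteRealification.
Context {R : realType} {X : completeNormedModType R[i]}.
Local Notation Xr := (realified R X).
Local Notation toC := (real_complex R).

Fact realified_complete (F : set_system Xr) :
  ProperFilter F -> cauchy F -> cvg F.
Proof.
move=> FF /cauchyP Fc.
have /cauchy_cvg FX : cauchy (F : set_system X).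
  apply/cauchyP => e e0; have re : toC (complex.Re e) = e.
    by apply: RRe_real; exact: gtr0_real.
  have [|x Fx] := Fc (complex.Re e); first by rewrite -ltcR re.
  exists x; apply: filterS Fx => y; rewrite -!ball_normE/=.
  by rewrite -ltcR re real_normE.
apply/cvg_ex; exists (lim (F : set_system X)) => A /nbhs_realified.
exact: FX.
Qed.

HB.instance Definition _ := Uniform_isComplete.Build Xr realified_complete.

End CompleteRealification.

(** * Separation and projections over both scalar fields *)

Section Distance.
Context {R : realType} {X : normedModType R}.
Variable L : set X.
Hypothesis cL : closed_subspace L.

Let dist x : R := inf [set `|x - l| | l in L].

Let dist_le x l : L l -> dist x <= `|x - l|.
Proof. by move=> Ll; apply: ge_inf; [exists 0 => _ [? _ <-]|exists l]. Qed.

Let le_dist x r : (forall l, L l -> r <= `|x - l|) -> r <= dist x.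
Proof.
move=> rle; apply: lb_le_inf; first by exists `|x - 0|, 0 => //; exact: cL.1.1.
by move=> _ [l Ll <-]; exact: rle.
Qed.

Let dist_sublinear : sublinear dist.
Proof.
split=> [x y|t x t0].
  rewrite -lerBlDl; apply: le_dist => m Mm.
  rewrite lerBlDl -lerBlDr; apply: le_dist => l Ll; rewrite lerBlDr.
  apply: le_trans (dist_le _ (linear_subspaceD cL.1 Ll Mm)) _.
  by rewrite opprD addrACA ler_normD.
rewrite -ler_pdivrMl//; apply: le_dist => l Ll; rewrite ler_pdivrMl//.
apply: le_trans (dist_le _ (linear_subspaceZ t cL.1 Ll)) _.
by rewrite -scalerBr normrZ gtr0_norm.
Qed.

Let dist_gt0 x : ~ L x -> 0 < dist x.
Proof.
move=> nLx; have : nbhs x (~` L).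
  by apply: open_nbhs_nbhs; split=> //; apply: closed_openC; exact: cL.2.
move=> /nbhs_ballP[e /= e0 eL]; apply: lt_le_trans e0 _.
apply: le_dist => l Ll; rewrite leNgt; apply/negP => xle.
by apply: (eL l) => //; rewrite -ball_normE.
Qed.

(** The distance to [L] is sublinear, vanishes on [L], and is positive off [L]
    since [L] is closed: a linear functional below it that agrees with it at
    [x0] separates [x0] from [L]. *)
Lemma separating_functional_real x0 : ~ L x0 ->
  exists f : X -> R, [/\ scalar f, forall x, `|f x| <= `|x|,
    forall l, L l -> f l = 0 & f x0 != 0].
Proof.
move=> /dist_gt0 x0_gt0.
have [f linf [fx0 fle]] := hahn_banach x0 dist_sublinear.
have fN x : f (- x) = - f x.
  have f0 : f 0 = 0 by have := linf 1 0 0; rewrite scaler0 addr0; lra.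
  by have := linf (-1) x 0; rewrite scaleN1r f0 !addr0 mulN1r.
exists f; split=> //; last by rewrite fx0 gt_eqF.
  have f_le x : f x <= `|x|.
    by apply: le_trans (fle x) _; rewrite -{2}[x]subr0 dist_le//; exact: cL.1.1.
  by move=> x; rewrite ler_norml lerNl -fN -{1}normrN !f_le.
move=> l Ll; apply/eqP; rewrite eq_le -oppr_le0 -fN.
have f_le0 y : L y -> f y <= 0.
  move=> Ly; apply: le_trans (fle y) _.
  by rewrite (le_trans (dist_le y Ly))// subrr normr0.
by rewrite !f_le0//; apply: linear_subspaceN => //; exact: cL.1.
Qed.

End Distance.

Section Complexification.
Context {R : realType} {X : normedModType R[i]}.
Local Notation toC := (real_complex R).
Local Notation ii := (Complex 0 1 : R[i]).

Lemma linear_subspace_realified (L : set X) :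
  linear_subspace L -> linear_subspace (L : set (realified R X)).
Proof. by move=> [L0 sL]; split=> // a x y; exact: (sL (toC a)). Qed.

Lemma closed_subspace_realified (L : set X) :
  closed_subspace L -> closed_subspace (L : set (realified R X)).
Proof.
by move=> [/linear_subspace_realified sL /closed_realified cL].
Qed.

(** From a real functional [u], the formula [u(x) - i u(i x)] produces a complex
    one with real part [u]; it vanishes on [L] because [L] is stable under
    multiplication by [i].  The bound 2 is crude but sufficient. *)
Lemma separating_functional_complex (L : set X) x0 :
  closed_subspace L -> ~ L x0 ->
  exists f : X -> R[i], [/\ scalar f, forall x, `|f x| <= 2 * `|x|,
    forall l, L l -> f l = 0 & f x0 != 0].
Proof.
move=> cL nLx0.
have [u [linu ule uL ux0]] :=
  separating_functional_real (closed_subspace_realified cL) nLx0.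
have uD (x y : X) : u (x + y) = u x + u y.
  by have := linu 1 x y; rewrite scale1r mul1r.
have u0 : u 0 = 0 by have := uD 0 0; rewrite addr0; lra.
have uZ (a : R) (x : X) : u (toC a *: x) = a * u x.
  by have := linu a x 0; rewrite u0 !addr0.
have uE (a b : R) x : u (Complex a b *: x) = a * u x + b * u (ii *: x).
  rewrite -!uZ -uD scalerA -scalerDl (_ : Complex a b = toC a + toC b * ii)//.
  apply/eqP; rewrite eq_complex /=.
  by rewrite !(mulr0, mul0r, mulr1, subr0, addr0, add0r) !eqxx.
exists (fun x => Complex (u x) (- u (ii *: x))); split.
- move=> [a b] x y; apply/eqP; rewrite eq_complex /= scalerDr !uD.
  rewrite scalerA (uE a b) (_ : ii * _ = Complex (- b) a); last first.
    apply/eqP; rewrite eq_complex /=.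
    by rewrite !(mulr0, mul0r, mul1r, subr0, addr0, add0r, sub0r) !eqxx.
  by rewrite (uE (- b) a); apply/andP; split; apply/eqP; lra.
- move=> x; have -> : Complex (u x) (- u (ii *: x)) =
      toC (u x) + toC (- u (ii *: x)) * ii.
    apply/eqP; rewrite eq_complex /=.
    by rewrite !(mulr0, mul0r, mulr1, subr0, addr0, add0r) !eqxx.
  have toC_norm (r : R) : `|toC r| = toC `|r|.
    by rewrite normc_def/= expr0n/= addr0 sqrtr_sqr.
  have i1 : `|ii| = 1 by rewrite normc_def/= expr0n expr1n/= add0r sqrtr1.
  have le_u (y : X) : `|toC (u y)| <= `|y|.
    by rewrite toC_norm -real_normE lecR; exact: ule.
  apply: le_trans (ler_normD _ _) _; rewrite mulr_natl mulr2n lerD//.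
  rewrite normrM i1 mulr1 rmorphN normrN; apply: le_trans (le_u _) _.
  by rewrite normrZ i1 mul1r.
- move=> l Ll; rewrite uL// uL ?oppr0//.
  by apply: linear_subspaceZ => //; exact: cL.1.
- by rewrite eq_complex /= negb_and ux0.
Qed.

End Complexification.

Section ScalarKind.
Context {R : realType} {k : scalar_kind}.

Lemma separating_functional (X : normedModType (scalars R k)) (L : set X) x0 :
  closed_subspace L -> ~ L x0 ->
  exists f : X -> scalars R k, [/\ bounded_functional f,
    forall l, L l -> f l = 0 & f x0 != 0].
Proof.
case: k X L x0 => X L x0 cL nLx0.
  have [f [linf fle fL fx0]] := separating_functional_real cL nLx0.
  by exists f; split=> //; split=> //; exists 1 => // x; rewrite mul1r.
have [f [linf fle fL fx0]] := separating_functional_complex cL nLx0.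
by exists f; split=> //; split=> //; exists 2.
Qed.

Lemma complemented_projection (X : completeNormedModType (scalars R k))
    (L : set X) : closed_subspace L -> complemented L ->
  exists P : X -> X, [/\ bounded_operator P, forall x, L (P x) &
    forall x, L x -> P x = x].
Proof.
move=> cL [M [cM LM0 sumLM]].
have [P PLM] := complement_projection cL.1 cM.1 LM0 sumLM.
have PL x : L x -> P x = x.
  move=> Lx; apply/eqP; rewrite eq_sym -subr_eq0.
  suff : (L `&` M) (x - P x) by rewrite LM0 => ->.
  by split; [exact: linear_subspaceB cL.1 Lx (PLM x).1|exact: (PLM x).2].
suff bP : exists C, forall x, `|P x| <= C * `|x|.
  exists P; split=> // [|x]; last exact: (PLM x).1.
  by split=> //; exact: linearP.
move: cL cM LM0 P PLM {PL sumLM}; case: k X L M => X L M cL cM LM0 P PLM.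
  exact: complement_projection_bounded cL cM LM0 PLM.
have linP : linear (P : realified R X -> realified R X).
  by move=> a x y; exact: (linearP P (real_complex R a)).
pose Q : {linear realified R X -> realified R X} :=
  HB.pack (P : realified R X -> realified R X)
    (GRing.isLinear.Build _ _ _ _ _ linP).
have [C QC] := @complement_projection_bounded R (realified R X) L M Q
  (closed_subspace_realified cL) (closed_subspace_realified cM) LM0 PLM.
exists (real_complex R C) => x.
by rewrite -!real_normE -rmorphM/= lecR; exact: QC.
Qed.

End ScalarKind.

(** * Nests and predecessors *)

Section NestMembers.
Context {K : numFieldType} {X : normedModType K}.
Implicit Types (A L M : set X) (N : nest X).

Lemma sub_closed_span A : A `<=` closed_span A.
Proof. exact: subset_trans (@sub_gen_smallest _ _ A) (@subset_closure _ _). Qed.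

Lemma closed_span_sub A L :
  closed_subspace L -> A `<=` L -> closed_span A `<=` L.
Proof.
move=> [sL cL] AL; rewrite [X in _ `<=` X](closure_id L).1//.
by apply: closure_subset; exact: smallest_sub.
Qed.

Lemma nest_prev_member N M : members N (nest_prev N M).
Proof.
have [_ _ _ nestF] := nestP N.
by apply: (nestF [set L | members N L /\ L `<` M] _).2 => L [].
Qed.

Lemma nest_member_closed N M : members N M -> closed_subspace M.
Proof. by have [/(_ M)] := nestP N. Qed.

Lemma nest_prev_closed N M : closed_subspace (nest_prev N M).
Proof. exact: nest_member_closed (nest_prev_member _ _). Qed.

Lemma nest_prev_sub N M : members N M -> nest_prev N M `<=` M.
Proof.
move=> NM; apply: closed_span_sub; first exact: nest_member_closed NM.
by move=> x [L [_ [LM _]] Lx]; exact: LM.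
Qed.

Lemma sub_nest_prev N L M : members N L -> L `<` M -> L `<=` nest_prev N M.
Proof. by move=> NL LM x Lx; apply: sub_closed_span; exists L. Qed.

Lemma nest_prev_ltVge N L M : members N L -> members N M ->
  L `<=` nest_prev N M \/ M `<=` L.
Proof.
move=> NL NM; have [ML|nML] := pselect (M `<=` L); [by right|left].
apply: sub_nest_prev => //; split=> //.
by have [_ /(_ _ _ NL NM)[]] := nestP N.
Qed.

(** The intersection [I] of the nonzero members is a member.  If it is nonzero
    it is the least nonzero one, and its predecessor is 0; if it is 0, the point
    [x] lies in it because every predecessor of [M] is contained in [M]. *)
Lemma nest_prev_separated N x :
  (forall M, members N M -> M <> [set 0] -> nest_prev N M x) -> x = 0.
Proof.
move=> prevx; pose F := [set M | members N M /\ M <> [set 0]].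
pose I := \bigcap_(M in F) M.
have [_ _ [N0 _] nestF] := nestP N.
have NI : members N I by apply: (nestF F _).1 => M [].
have Ix : I x by move=> M [NM M0]; apply: nest_prev_sub (prevx M NM M0).
have [I0|nI0] := pselect (I = [set 0]); first by rewrite I0 in Ix.
apply: (closed_span_sub (L := [set 0]) _ _ (prevx I NI nI0)).
  exact: nest_member_closed N0.
move=> y [L [NL [LI nIL]] Ly].
have [<-//|nL0] := pselect (L = [set 0]).
by case: nIL => z; apply.
Qed.

End NestMembers.

(** * Operators of a nest algebra *)

Section NestAlgebraTheory.
Context {K : numFieldType} {X : normedModType K} {N : nest X}.
Local Notation A := (nest_algebra N).
Implicit Types (P Q S T : A) (x y : X) (M : set X) (f g : X -> K).

HB.instance Definition _ (T : A) :=
  GRing.isLinear.Build K X X _ (nest_op T) (nest_op_linear T).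

Lemma nest_op_bounded (T : A) : exists C : K, forall x, `|T x| <= C * `|x|.
Proof. by have /asboolP[[]] := nest_opP T. Qed.

Lemma nest_op_invariant (T : A) M x : members N M -> M x -> M (T x).
Proof. by have /asboolP[_ TN] := nest_opP T; move=> NM; exact: TN. Qed.

Lemma nest_op_ker_closed (T : A) : closed_subspace [set x | T x = 0].
Proof.
split; first split; first by rewrite /= linear0.
  by move=> a x y /= Tx Ty; rewrite linearP/= Tx Ty scaler0 addr0.
move=> x ker_x; have [C TC] := nest_op_bounded T.
apply: contrapT => /eqP Tx0; have nTx : 0 < `|T x| by rewrite normr_gt0.
have nx : 0 < `|x|.
  by rewrite normr_gt0; apply: contra_neq Tx0 => ->; rewrite linear0.
have C0 : 0 < C by rewrite -(pmulr_lgt0 C nx) (lt_le_trans nTx).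
have [y [/= Ty0]] := ker_x _ (nbhsx_ballx x _ (divr_gt0 nTx C0)).
rewrite -ball_normE/= ltr_pdivlMr// mulrC; apply/negP.
by rewrite le_gtF// (le_trans _ (TC _))// linearB/= Ty0 subr0.
Qed.

Inductive idempotent_span : A -> Prop :=
| idempotent_span_gen P : P * P = P -> idempotent_span P
| idempotent_span_comb a S T : idempotent_span S -> idempotent_span T ->
    idempotent_span (a *: S + T).

Lemma idempotent_spanB S T :
  idempotent_span S -> idempotent_span T -> idempotent_span (S - T).
Proof.
by move=> sS sT; rewrite addrC -scaleN1r; exact: idempotent_span_comb.
Qed.

Lemma idempotent_spanZ a S : S * S = S -> idempotent_span (a *: S).
Proof.
move=> SS; rewrite -[_ *: _]addr0; apply: idempotent_span_comb.
  exact: idempotent_span_gen.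
by apply: idempotent_span_gen; rewrite mul0r.
Qed.

(** Vanishing on the predecessor of [M] is what makes [y |-> f(y) x], with [x]
    in [M], leave every member of the nest invariant. *)
Definition nest_functional (M : set X) (f : X -> K) : Prop :=
  bounded_functional f /\ forall x, nest_prev N M x -> f x = 0.

Definition rank_one (x : X) (f : X -> K) (S : A) : Prop :=
  exists M,
    [/\ members N M, M x, nest_functional M f & forall y, S y = f y *: x].

Lemma nest_functionalD M f g : nest_functional M f -> nest_functional M g ->
  nest_functional M (fun x => f x + g x).
Proof.
move=> [[linf [C C0 fC]] f0] [[ling [D D0 gD]] g0]; split; last first.
  by move=> x Mx; rewrite f0// g0// addr0.
split=> [a x y|]; first by rewrite linf ling mulrDr addrACA.
exists (C + D); first exact: addr_ge0.
by move=> x; rewrite mulrDl (le_trans (ler_normD _ _))// lerD.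
Qed.

Lemma nest_functional_comp M f (T : A) : nest_functional M f ->
  nest_functional M (f \o T).
Proof.
move=> [[linf [C C0 fC]] f0]; split; last first.
  move=> x Mx; apply: f0.
  exact: (nest_op_invariant T (nest_prev_member N M) Mx).
split=> [a x y|]; first by rewrite /= linearP linf.
have [D TD] := nest_op_bounded T; exists (C * `|D|); first by rewrite mulr_ge0.
move=> x /=; apply: le_trans (fC _) _; rewrite -mulrA ler_wpM2l//.
apply: le_trans (TD x) _.
have [->|x0] := eqVneq x 0; first by rewrite normr0 !mulr0.
have D0 : 0 <= D.
  by rewrite -(pmulr_lge0 D (x := `|x|)) ?normr_gt0// (le_trans _ (TD _)).
by rewrite ger0_norm.
Qed.

(** A member either is contained in the predecessor of [M], where [f] vanishes,
    or contains [M] and with it the range of the operator. *)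
Lemma rank_one_exists M x f : members N M -> M x -> nest_functional M f ->
  exists S : A, rank_one x f S.
Proof.
move=> NM Mx Mf; have [[linf [C C0 fC]] f0] := Mf.
have Sin : (fun y => f y *: x) \in in_nest_algebra N.
  apply/asboolP; split; first split.
  - by move=> a y z; rewrite linf scalerDl scalerA.
  - by exists (C * `|x|) => y; rewrite normrZ mulrAC ler_wpM2r.
  - move=> L NL y Ly; have sL := (nest_member_closed NL).1.
    have [LM|ML] := nest_prev_ltVge NL NM.
      by rewrite f0; [rewrite scale0r; exact: sL.1|exact: LM].
    by apply: linear_subspaceZ => //; exact: ML.
by exists (NestAlgebra Sin), M.
Qed.

Lemma rank_one_mulr x f S T : rank_one x f S -> rank_one x (f \o T) (S * T).
Proof.
move=> [M [NM Mx Mf Sf]]; exists M; split=> // [|y].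
  exact: nest_functional_comp.
by rewrite nest_opM Sf.
Qed.

Lemma rank_one_mull x f S T : rank_one x f S -> rank_one (T x) f (T * S).
Proof.
move=> [M [NM Mx Mf Sf]]; exists M; split=> // [|y].
  exact: (nest_op_invariant T NM Mx).
by rewrite nest_opM Sf linearZ.
Qed.

(** The operator satisfies [S * S = f x *: S], hence [(f x)^-1 *: S] is
    idempotent. *)
Lemma rank_one_span_neq0 x f S :
  rank_one x f S -> f x != 0 -> idempotent_span S.
Proof.
move=> [M [NM Mx _ Sf]] fx0.
have SS : S * S = f x *: S.
  apply: nest_op_ext => y.
  by rewrite nest_opM nest_opZ (Sf y) linearZ/= Sf !scalerA mulrC.
rewrite -[S](scalerKV fx0).
apply: idempotent_spanZ; rewrite -nest_scalerAl -nest_scalerAr SS !scalerA.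
by rewrite -mulrA mulVf// mulr1.
Qed.

End NestAlgebraTheory.

Arguments nest_functional {K X} N M f.

(** * Maps annihilating triple products with zero factors *)

Section TripleProducts.
Context {K : numFieldType} {X : normedModType K} {N : nest X}.
Local Notation A := (nest_algebra N).
Implicit Types P Q S T : A.
Variable delta : {linear A -> A}.

Definition left_defect S T : A := delta (S * T) - S * delta T.

(** This is [delta(STQ) - delta(ST) Q - S delta(TQ) + S delta(T) Q].  Grouping
    the terms through [left_defect] turns linearity and the product rules
    [defect_mull] and [defect_mulr] into telescoping sums. *)
Definition defect S T Q : A := left_defect S (T * Q) - left_defect S T * Q.

Lemma left_defect_combl a S S' T :
  left_defect (a *: S + S') T = a *: left_defect S T + left_defect S' T.
Proof.
rewrite /left_defect !mulrDl -!nest_scalerAl linearP/= scalerBr.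
by rewrite opprD addrACA.
Qed.

Lemma left_defect_combr a S T T' :
  left_defect S (a *: T + T') = a *: left_defect S T + left_defect S T'.
Proof.
rewrite /left_defect linearP/= !mulrDr -!nest_scalerAr linearP/= scalerBr.
by rewrite opprD addrACA.
Qed.

Lemma left_defect_mull S S' T :
  left_defect (S * S') T = left_defect S (S' * T) + S * left_defect S' T.
Proof. by rewrite /left_defect mulrBr !mulrA addrA subrK. Qed.

Lemma defect_combl a S S' T Q :
  defect (a *: S + S') T Q = a *: defect S T Q + defect S' T Q.
Proof.
rewrite /defect scalerBr !left_defect_combl mulrDl -nest_scalerAl.
by rewrite opprD addrACA.
Qed.

Lemma defect_combr a S T Q Q' :
  defect S T (a *: Q + Q') = a *: defect S T Q + defect S T Q'.
Proof.
rewrite /defect scalerBr !mulrDr -!nest_scalerAr left_defect_combr.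
by rewrite opprD addrACA.
Qed.

Lemma defect_mull S S' T Q :
  defect (S * S') T Q = defect S (S' * T) Q + S * defect S' T Q.
Proof.
rewrite /defect mulrBr !left_defect_mull mulrDl opprD addrACA.
by rewrite !mulrA.
Qed.

Lemma defect_mulr S T Q Q' :
  defect S T (Q * Q') = defect S (T * Q) Q' + defect S T Q * Q'.
Proof.
rewrite /defect (mulrBl Q' (left_defect S (T * Q))) !mulrA.
by rewrite addrA subrK.
Qed.

Lemma defect_eq0_derivation : (forall S T Q, defect S T Q = 0) ->
  generalized_derivation delta.
Proof.
move=> defect0; pose tau S := delta S - delta 1 * S.
have lin_tau : linear tau.
  move=> a S T; rewrite /tau linearP/= mulrDr -nest_scalerAr scalerBr opprD.
  by rewrite addrACA.
pose tauL : {linear A -> A} :=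
  HB.pack tau (GRing.isLinear.Build _ _ _ _ _ lin_tau).
exists tauL => S Q; rewrite /= /tau mulrBr mulrA; apply/eqP.
have /eqP := defect0 S 1 Q.
rewrite /defect /left_defect mul1r mulr1 subr_eq0 subr_eq mulrBl.
by rewrite addrAC addrA.
Qed.

Hypothesis delta0 : forall S T Q : A,
  S * T = 0 -> T * Q = 0 -> S * delta T * Q = 0.

Lemma idempotentC P : P * P = P -> (1 - P) * (1 - P) = 1 - P.
Proof. by move=> PP; rewrite mulrBr mulr1 mulrBl mul1r PP subrr subr0. Qed.

(** Splitting [T Q] as [P T Q + (1 - P) T Q] leaves the two terms
    [(1 - P) delta(P T Q)] and [P delta((1 - P) T Q)]; multiplied by [1 - Q] on
    the right, both are triple products killed by the hypothesis. *)
Lemma left_defect_idempotent P T Q : P * P = P -> Q * Q = Q ->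
  left_defect P (T * Q) * (1 - Q) = 0.
Proof.
move=> PP QQ.
have PC : (1 - P) * P = 0 by rewrite mulrBl mul1r PP subrr.
have CP : P * (1 - P) = 0 by rewrite mulrBr mulr1 PP subrr.
have QC : Q * (1 - Q) = 0 by rewrite mulrBr mulr1 QQ subrr.
have split_delta : left_defect P (T * Q) =
    (1 - P) * delta (P * T * Q) - P * delta ((1 - P) * T * Q).
  rewrite /left_defect !mulrBl !mul1r linearB/= mulrBr opprB addrA.
  by rewrite subrK mulrA.
rewrite split_delta mulrBl !delta0 ?subrr//.
- by rewrite !mulrA CP !mul0r.
- by rewrite -!mulrA QC !mulr0.
- by rewrite !mulrA PC !mul0r.
- by rewrite -!mulrA QC !mulr0.
Qed.

(** The preceding lemma for [Q] gives [c(TQ) = c(TQ) Q], and for [1 - Q] gives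
    [c(T) Q = c(TQ) Q], where [c = left_defect P]. *)
Lemma defect_idempotent P T Q : P * P = P -> Q * Q = Q -> defect P T Q = 0.
Proof.
move=> PP QQ.
have := left_defect_idempotent T PP (idempotentC QQ).
rewrite subKr mulrBr mulr1.
have := left_defect_idempotent T PP QQ.
rewrite mulrBr mulr1 => /eqP; rewrite subr_eq0 => /eqP defQ.
rewrite -scaleN1r addrC left_defect_combr scaleN1r mulrDl mulNr -defQ addrC.
by move=> /eqP; rewrite subr_eq0 /defect => /eqP ->; rewrite subrr.
Qed.

Lemma defect_idempotent_span S T Q :
  idempotent_span S -> idempotent_span Q -> defect S T Q = 0.
Proof.
move=> spanS spanQ; elim: spanS => [P PP|a S1 S2 _ IH1 _ IH2]; last first.
  by rewrite defect_combl IH1 IH2 scaler0 addr0.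
elim: spanQ => [Q' QQ|a Q1 Q2 _ IH1 _ IH2]; first exact: defect_idempotent.
by rewrite defect_combr IH1 IH2 scaler0 addr0.
Qed.

End TripleProducts.

(** * Rank one operators and idempotents *)

Section NestAlgebraRankOne.
Context {R : realType} {k : scalar_kind}.
Context {X : completeNormedModType (scalars R k)} {N : nest X}.
Hypothesis complN :
  forall L, members N L -> nest_prev N L = L -> complemented L.
Local Notation A := (nest_algebra N).
Implicit Types (P Q S T U V Z : A) (x y : X) (M : set X).
Implicit Types f g : X -> scalars R k.

Lemma nest_functional_separation M x : ~ nest_prev N M x ->
  exists2 f, nest_functional N M f & f x != 0.
Proof.
move=> /(separating_functional (nest_prev_closed N M))[f [bf f0 fx]].
by exists f.
Qed.

(** Let [y] be in [M] but not in its predecessor.  If [f y != 0] the operator is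
    a multiple of an idempotent.  Otherwise write [f] as [(f + h) - h] with [h]
    nonzero at [y]: neither [f + h] nor [h] vanishes at [y].  A point [x] of the
    predecessor is [(x + z) - z], where both [x + z] and [z] are such points. *)
Lemma rank_one_span_prev_neq M x f S :
  members N M -> nest_prev N M <> M -> M x -> nest_functional N M f ->
  (forall y, S y = f y *: x) -> idempotent_span S.
Proof.
move=> NM prevM Mx Mf Sf.
have notin_prev y T : M y -> ~ nest_prev N M y -> (forall z, T z = f z *: y) ->
    idempotent_span T.
  move=> My nprev Tf.
  have [fy0|fy0] := eqVneq (f y) 0; last first.
    by apply: rank_one_span_neq0 fy0; exists M.
  have [h Mh hy] := nest_functional_separation nprev.
  have [U rU] := rank_one_exists NM My (nest_functionalD Mf Mh).
  have [V rV] := rank_one_exists NM My Mh.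
  suff -> : T = U - V.
    apply: idempotent_spanB; last exact: rank_one_span_neq0 rV hy.
    by apply: rank_one_span_neq0 rU _; rewrite fy0 add0r.
  have [_ [_ _ _ Uf]] := rU; have [_ [_ _ _ Vf]] := rV.
  apply: nest_op_ext => z; rewrite nest_opD -[(- V) z]/(- V z) Tf Uf Vf.
  by rewrite scalerDl addrK.
have [z [Mz nz]] : exists z, M z /\ ~ nest_prev N M z.
  apply: contrapT => nex; apply: prevM; apply/seteqP; split.
    exact: nest_prev_sub.
  by move=> z Mz; apply: contrapT => nz; apply: nex; exists z.
have sM := (nest_member_closed NM).1.
have [px|npx] := pselect (nest_prev N M x); last exact: notin_prev npx Sf.
have Mxz : M (x + z) := linear_subspaceD sM Mx Mz.
have [U rU] := rank_one_exists NM Mxz Mf.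
have [V rV] := rank_one_exists NM Mz Mf.
have [_ [_ _ _ Uf]] := rU; have [_ [_ _ _ Vf]] := rV.
have -> : S = U - V.
  apply: nest_op_ext => y; rewrite nest_opD -[(- V) y]/(- V y) Sf Uf Vf.
  by rewrite scalerDr addrK.
apply: idempotent_spanB; last exact: notin_prev nz Vf.
apply: notin_prev Mxz _ Uf => pxz; apply: nz.
have := linear_subspaceB (nest_prev_closed N M).1 pxz px.
by rewrite addrC addKr.
Qed.

(** When [M] is its own predecessor, [f] vanishes on [M].  A bounded projection
    [P] onto [M] belongs to the algebra, since members of the nest lie below or
    above [M], and [P S = S], [S P = 0] make [P + S] idempotent. *)
Lemma rank_one_idempotent_span x f S : rank_one x f S -> idempotent_span S.
Proof.
move=> [M [NM Mx Mf Sf]].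
have [prevM|] := pselect (nest_prev N M = M); last first.
  by move=> prevM; exact: rank_one_span_prev_neq prevM Mx Mf Sf.
have [P0 [bP PM Pid]] :=
  complemented_projection (nest_member_closed NM) (complN NM prevM).
have NP : P0 \in in_nest_algebra N.
  apply/asboolP; split=> // L NL y Ly.
  have [_ /(_ _ _ NL NM)[LM|ML] _ _] := nestP N; last exact: ML.
  by rewrite Pid//; exact: LM.
pose P : A := NestAlgebra NP.
have f0 y : M y -> f y = 0 by move=> My; apply: Mf.2; rewrite prevM.
have PP : P * P = P by apply: nest_op_ext => y; exact: Pid.
have PS : P * S = S.
  by apply: nest_op_ext => y; rewrite nest_opM Sf linearZ/= Pid.
have SP : S * P = 0.
  by apply: nest_op_ext => y; rewrite nest_opM Sf f0 ?scale0r//; exact: PM.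
have SS : S * S = 0 by rewrite -{2}PS mulrA SP mul0r.
rewrite -[S](addrK P).
apply: idempotent_spanB; apply: idempotent_span_gen => //.
by rewrite mulrDl !mulrDr SS SP PS PP addr0 add0r.
Qed.

(** Testing on rank one operators at [M] and [L] gives [f (Z y) = 0] for [y] in
    [L] and all [f] vanishing on the predecessor of [M], provided some nonzero
    functional vanishes on the predecessor of [L].  Then [Z y] lies in every
    predecessor of a nonzero member, so [Z y = 0].  The proviso fails at most
    for the whole space; in that case the space is the closed span of its
    proper members, on which [Z] already vanishes. *)
Lemma rank_one_faithful Z :
  (forall x f y g U V, rank_one x f U -> rank_one y g V -> U * Z * V = 0) ->
  Z = 0.
Proof.
move=> UZV0.
have prev_neq L y : members N L -> nest_prev N L <> setT -> L y -> Z y = 0.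
  move=> NL prevL Ly; apply: (nest_prev_separated (N := N)) => M NM M0.
  apply: contrapT => /nest_functional_separation[f Mf].
  have [w nw] : exists w, ~ nest_prev N L w.
    apply: contrapT => nex; apply: prevL; apply/seteqP; split=> // w _.
    by apply: contrapT => nw; apply: nex; exists w.
  have [g Lg gw] := nest_functional_separation nw.
  have [x [Mx x0]] : exists x, M x /\ x != 0.
    apply: contrapT => nex; apply: M0; apply/seteqP; split=> x.
      by move=> Mx; apply: contrapT => /eqP x0; apply: nex; exists x.
    by move=> ->; exact: (nest_member_closed NM).1.1.
  have [U rU] := rank_one_exists NM Mx Mf.
  have [V rV] := rank_one_exists NL Ly Lg.
  have [_ [_ _ _ Uf]] := rU; have [_ [_ _ _ Vg]] := rV.
  have := congr1 (fun T : A => T w) (UZV0 _ _ _ _ _ _ rU rV).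
  rewrite !nest_opM Vg !linearZ/= Uf => /eqP.
  by rewrite !scaler_eq0 (negPf gw) (negPf x0) orbF orFb => ->.
apply: nest_op_ext => y; rewrite -[RHS]/(0 : X).
have NT : members N setT by have [_ _ []] := nestP N.
have [prevT|/prev_neq] := pselect (nest_prev N setT = setT); last exact.
have : nest_prev N setT y by rewrite prevT.
apply: (closed_span_sub (nest_op_ker_closed Z)).
move=> z [M [NM [_ nTM]] Mz]; apply: (prev_neq M) => // prevM; apply: nTM.
by rewrite -prevM; exact: nest_prev_sub.
Qed.

(** For [S] arbitrary, [U S] is again of rank one, so the product rule on the
    left yields [U E(S, T, V) = 0]; the product rule on the right then turns
    [U E(S, T, Q V) = 0] into the claim. *)
Lemma defect_between_rank_ones (delta : {linear A -> A})
    (delta0 : forall S T Q, S * T = 0 -> T * Q = 0 -> S * delta T * Q = 0)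
    S T Q x f y g U V :
  rank_one x f U -> rank_one y g V -> U * defect delta S T Q * V = 0.
Proof.
have mul_defect S' T' x' f' y' g' U' V' : rank_one x' f' U' ->
    rank_one y' g' V' -> U' * defect delta S' T' V' = 0.
  move=> rU rV; have spanV := rank_one_idempotent_span rV.
  have := defect_mull delta U' S' T' V'.
  have spanUS := rank_one_idempotent_span (rank_one_mulr S' rU).
  have spanU := rank_one_idempotent_span rU.
  rewrite (defect_idempotent_span delta0 _ spanUS spanV).
  by rewrite (defect_idempotent_span delta0 _ spanU spanV) add0r.
move=> rU rV.
have -> : U * defect delta S T Q * V =
    U * (defect delta S T (Q * V) - defect delta S (T * Q) V).
  by rewrite defect_mulr addrC addKr mulrA.
rewrite mulrBr (mul_defect _ _ _ _ _ _ _ _ rU rV).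
by rewrite (mul_defect _ _ _ _ _ _ _ _ rU (rank_one_mull Q rV)) subrr.
Qed.

Lemma annihilating_generalized_derivation (delta : {linear A -> A}) :
  (forall S T Q, S * T = 0 -> T * Q = 0 -> S * delta T * Q = 0) ->
  generalized_derivation delta.
Proof.
move=> delta0; apply: defect_eq0_derivation => S T Q.
apply: rank_one_faithful => x f y g U V.
exact: defect_between_rank_ones.
Qed.

End NestAlgebraRankOne.

(** * The equivalence *)

(** For a generalized derivation [d] with companion [tau], [d(TQ) = 0] gives
    [d(T) Q = - T tau(Q)], which [S] annihilates; only the value of [delta] at
    [T] enters. *)
Lemma local_derivation_annihilating (K : numFieldType) (X : normedModType K)
    (N : nest X) (delta : {linear nest_algebra N -> nest_algebra N}) :
  local_generalized_derivation delta ->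
  forall S T Q : nest_algebra N,
    S * T = 0 -> T * Q = 0 -> S * delta T * Q = 0.
Proof.
move=> locd S T Q ST TQ; have [d [tau dtau] ->] := locd T.
have /eqP := dtau T Q.
rewrite TQ linear0 eq_sym addr_eq0 => /eqP dTQ.
by rewrite -mulrA dTQ mulrN mulrA ST mul0r oppr0.
Qed.

Theorem corollary3p6 (R : realType) (k : scalar_kind)
    (X : completeNormedModType (scalars R k)) (dimX : dim_ge X 2)
    (N : nest X)
    (complN : forall L, members N L -> nest_prev N L = L -> complemented L)
    (delta : {linear nest_algebra N -> nest_algebra N}) :
  [<-> generalized_derivation delta;
       local_generalized_derivation delta;
       forall A B C : nest_algebra N,
         A * B = 0 -> B * C = 0 -> A * delta B * C = 0].
Proof.
tfae.
- by move=> gd a; exists delta.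
- exact: local_derivation_annihilating.
- move=> delta0; exact (annihilating_generalized_derivation complN delta0).
Qed.
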